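(* Let $(\mathcal{P},\Pi,\mathrel{h})$ be a point–plane incidence structure satisfying Axioms [1]–[4] described in the context. Then Axiom [H] holds if and only if its spatial dual, Axiom [H$^*$], holds. Axiom [H]: for every plane $\pi\in\Pi$ and all points $P_0,P_1,P_2,P_3\in\pi^{h}$ such that $\{P_i,P_j,P_k\}^{h}=\{\pi\}$ for all distinct $i,j,k\in\{0,1,2,3\}$, the points $D_1,D_2,D_3$ defined by $\{D_1\}=\{P_0,P_1\}^{hh}\cap\{P_2,P_3\}^{hh}$, $\{D_2\}=\{P_0,P_2\}^{hh}\cap\{P_3,P_1\}^{hh}$, $\{D_3\}=\{P_0,P_3\}^{hh}\cap\{P_1,P_2\}^{hh}$ satisfy $\{D_1,D_2,D_3\}^{h}=\{\pi\}$. Axiom [H$^*$]: for every point $P\in\mathcal{P}$ and all planes $\pi_0,\pi_1,\pi_2,\pi_3\in P^{h}$ such that $\{\pi_i,\pi_j,\pi_k\}^{h}=\{P\}$ for all distinct $i,j,k\in\{0,1,2,3\}$, the planes $\delta_1,\delta_2,\delta_3$ defined by $\{\delta_1\}=\{\pi_0,\pi_1\}^{hh}\cap\{\pi_2,\pi_3\}^{hh}$, $\{\delta_2\}=\{\pi_0,\pi_2\}^{hh}\cap\{\pi_3,\pi_1\}^{hh}$, $\{\delta_3\}=\{\pi_0,\pi_3\}^{hh}\cap\{\pi_1,\pi_2\}^{hh}$ satisfy $\{\delta_1,\delta_2,\delta_3\}^{h}=\{P\}$.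
   Context: $\mathcal{P}$ (points) and $\Pi$ (planes) are disjoint nonempty sets with an incidence relation $\mathrel{h}\subseteq \mathcal{P}\times\Pi$ (written symmetrically: $P\mathrel{h}\pi$ and $\pi\mathrel{h}P$ mean the same). For $\mathbf{S}\subseteq\mathcal{P}$, $\mathbf{S}^{h}\subseteq\Pi$ is the set of planes incident with every point of $\mathbf{S}$; for $\mathbf{\Sigma}\subseteq\Pi$, $\mathbf{\Sigma}^{h}\subseteq\mathcal{P}$ is the set of points incident with every plane of $\mathbf{\Sigma}$; $O^h=\{O\}^h$, $\omega^h=\{\omega\}^h$, and $X^{hh}=(X^h)^h$. $\mathbf{S}\mathrel{h}\mathbf{\Sigma}$ means $P\mathrel{h}\pi$ for all $P\in\mathbf{S},\pi\in\mathbf{\Sigma}$. The axioms are: [1] For every $P\in\mathcal{P}$, $P^h\neq\Pi$; for every $\pi\in\Pi$, $\pi^h\neq\mathcal{P}$. [2] For all $A,B\in\mathcal{P}$, $|\{A,B\}^h|>2$; for all $\alpha,\beta\in\Pi$, $|\{\alpha,\beta\}^h|>2$. [3] For all $A,B,C\in\mathcal{P}$, $\{A,B,C\}^h\neq\emptyset$; for all $\alpha,\beta,\gamma\in\Pi$, $\{\alpha,\beta,\gamma\}^h\neq\emptyset$. [4] If $A\neq B$ in $\mathcal{P}$, $\alpha\neq\beta$ in $\Pi$ and $\{A,B\}\mathrel{h}\{\alpha,\beta\}$, then $\{A,B\}^h=\{\alpha,\beta\}^{hh}$ and $\{\alpha,\beta\}^h=\{A,B\}^{hh}$. Under these axioms,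 the sets $\{D_i\}$ and $\{\delta_i\}$ in the claim are indeed singletons (in the corresponding configurations, the two intersected sets always meet in exactly one element), so $D_i$ and $\delta_i$ are well defined. *)

(* Defs.v *)
From mathcomp Require Import all_boot.
From mathcomp Require Import boolp classical_sets functions cardinality.

Set Implicit Arguments.
Unset Strict Implicit.
Unset Printing Implicit Defensive.

Local Open Scope classical_set_scope.

(* Points and planes are separate types, so the sets they stand for are
   disjoint by construction. *)

(* S^h, for a set S of points *)
Definition planes_on (Point Plane : Type) (h : Point -> Plane -> Prop)
    (S : set Point) : set Plane :=
  [set pi | forall P, S P -> h P pi].

(* Sigma^h, for a set Sigma of planes *)
Definition points_on (Point Plane : Type) (h : Point -> Plane -> Prop)
    (Sigma : set Plane) : set Point :=
  [set P | forall pi, Sigma pi -> h P pi].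

(* S^hh *)
Definition point_closure (Point Plane : Type) (h : Point -> Plane -> Prop)
    (S : set Point) : set Point :=
  points_on h (planes_on h S).

(* Sigma^hh *)
Definition plane_closure (Point Plane : Type) (h : Point -> Plane -> Prop)
    (Sigma : set Plane) : set Plane :=
  planes_on h (points_on h Sigma).

(* S h Sigma *)
Definition incident_sets (Point Plane : Type) (h : Point -> Plane -> Prop)
    (S : set Point) (Sigma : set Plane) : Prop :=
  forall P pi, S P -> Sigma pi -> h P pi.

Definition axiom1 (Point Plane : Type) (h : Point -> Plane -> Prop) : Prop :=
  (forall P : Point, planes_on h [set P] <> [set: Plane]) /\
  (forall pi : Plane, points_on h [set pi] <> [set: Point]).

(* `I_3 #<= X says |X| > 2, for X finite or infinite; A = B is allowed. *)
Definition axiom2 (Point Plane : Type) (h : Point -> Plane -> Prop) : Prop :=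
  (forall A B : Point, (`I_3 #<= planes_on h [set A; B])%card) /\
  (forall alpha beta : Plane, (`I_3 #<= points_on h [set alpha; beta])%card).

Definition axiom3 (Point Plane : Type) (h : Point -> Plane -> Prop) : Prop :=
  (forall A B C : Point, planes_on h [set A; B; C] <> set0) /\
  (forall alpha beta gamma : Plane,
      points_on h [set alpha; beta; gamma] <> set0).

Definition axiom4 (Point Plane : Type) (h : Point -> Plane -> Prop) : Prop :=
  forall (A B : Point) (alpha beta : Plane),
    A <> B -> alpha <> beta ->
    incident_sets h [set A; B] [set alpha; beta] ->
    planes_on h [set A; B] = plane_closure h [set alpha; beta] /\
    points_on h [set alpha; beta] = point_closure h [set A; B].

(* The condition over all distinct i, j, k is listed once per unordered triple.
   axiom1 to axiom4 ensure that D1, D2, D3 exist and are unique, so quantifying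
   universally over them amounts to naming them. *)
Definition axiomH (Point Plane : Type) (h : Point -> Plane -> Prop) : Prop :=
  forall (pi : Plane) (P0 P1 P2 P3 : Point),
    points_on h [set pi] P0 -> points_on h [set pi] P1 ->
    points_on h [set pi] P2 -> points_on h [set pi] P3 ->
    planes_on h [set P0; P1; P2] = [set pi] ->
    planes_on h [set P0; P1; P3] = [set pi] ->
    planes_on h [set P0; P2; P3] = [set pi] ->
    planes_on h [set P1; P2; P3] = [set pi] ->
    forall D1 D2 D3 : Point,
      [set D1] = point_closure h [set P0; P1] `&` point_closure h [set P2; P3] ->
      [set D2] = point_closure h [set P0; P2] `&` point_closure h [set P3; P1] ->
      [set D3] = point_closure h [set P0; P3] `&` point_closure h [set P1; P2] ->
      planes_on h [set D1; D2; D3] = [set pi].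

Definition axiomHstar (Point Plane : Type) (h : Point -> Plane -> Prop) : Prop :=
  forall (P : Point) (pi0 pi1 pi2 pi3 : Plane),
    planes_on h [set P] pi0 -> planes_on h [set P] pi1 ->
    planes_on h [set P] pi2 -> planes_on h [set P] pi3 ->
    points_on h [set pi0; pi1; pi2] = [set P] ->
    points_on h [set pi0; pi1; pi3] = [set P] ->
    points_on h [set pi0; pi2; pi3] = [set P] ->
    points_on h [set pi1; pi2; pi3] = [set P] ->
    forall d1 d2 d3 : Plane,
      [set d1] = plane_closure h [set pi0; pi1] `&` plane_closure h [set pi2; pi3] ->
      [set d2] = plane_closure h [set pi0; pi2] `&` plane_closure h [set pi3; pi1] ->
      [set d3] = plane_closure h [set pi0; pi3] `&` plane_closure h [set pi1; pi2] ->
      points_on h [set d1; d2; d3] = [set P].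

(* Main.v *)
Require Import Defs.
From mathcomp Require Import all_boot.
From mathcomp Require Import boolp classical_sets functions cardinality.

Local Open Scope classical_set_scope.

(** The axioms are self-dual, so it is enough to derive [H*] from [H].  Given
    four planes [pi_i] through [P], cut them with a plane [sigma] that misses
    [P]: this gives a complete quadrilateral in [sigma], with vertices [A_ij] on
    [pi_i] and [pi_j].  If the diagonal planes had a common point besides [P],
    they would have a common point [Y] in [sigma].  The quadrangle
    [A_01, A_23, A_02, A_13] has diagonal points [Y], [A_03], [A_12], all of
    which lie on the third diagonal plane, contradicting [H]. *)

Section Incidence.
Variables (Point Plane : Type) (h : Point -> Plane -> Prop).

Lemma planes_on1E A pi : planes_on h [set A] pi <-> h A pi.
Proof. by split=> [|hA _ ->]; first exact. Qed.

Lemma planes_on2E A B pi : planes_on h [set A; B] pi <-> h A pi /\ h B pi.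
Proof.
split=> [H|[hA hB] _ [|] -> //].
by split; apply: H; [left | right].
Qed.

Lemma planes_on3E A B C pi :
  planes_on h [set A; B; C] pi <-> [/\ h A pi, h B pi & h C pi].
Proof.
split=> [H|[hA hB hC] _ [[|]|] -> //].
by split; apply: H; [left; left | left; right | right].
Qed.

Lemma planes_on3_eq1 A B C pi : h A pi -> h B pi -> h C pi ->
    (forall tau, h A tau -> h B tau -> h C tau -> tau = pi) ->
  planes_on h [set A; B; C] = [set pi].
Proof.
move=> hA hB hC uniq; apply/seteqP; split=> tau.
  by move=> /planes_on3E[]; exact: uniq.
by move=> ->; apply/planes_on3E.
Qed.

Lemma plane_avoiding P : axiom1 h -> exists pi, ~ h P pi.
Proof.
move=> [ax1 _]; apply: contrapT => all_on; apply: (ax1 P).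
apply/seteqP; split=> // pi _; apply/planes_on1E; apply: contrapT => nh.
by apply: all_on; exists pi.
Qed.

End Incidence.

Arguments planes_on1E {Point Plane h A pi}.
Arguments planes_on2E {Point Plane h A B pi}.
Arguments planes_on3E {Point Plane h A B C pi}.

Section DualIncidence.
Variables (Point Plane : Type) (h : Point -> Plane -> Prop).
(** Points and planes swapped: [planes_on dual_h] is convertible to [points_on h]. *)
Let dual_h pi P := h P pi.

Lemma points_on2E a b P : points_on h [set a; b] P <-> h P a /\ h P b.
Proof. exact: (@planes_on2E _ _ dual_h). Qed.

Lemma points_on3E a b c P :
  points_on h [set a; b; c] P <-> [/\ h P a, h P b & h P c].
Proof. exact: (@planes_on3E _ _ dual_h). Qed.

Lemma common_point a b c : axiom3 h -> exists P, [/\ h P a, h P b & h P c].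
Proof.
move=> [_ ax3]; have /eqP/set0P[P /points_on3E ?] := ax3 a b c.
by exists P.
Qed.

Lemma point_closure2E A B C :
  point_closure h [set A; B] C <-> forall c, h A c -> h B c -> h C c.
Proof.
split=> [H c hA hB|H c /planes_on2E[]]; last exact: H.
by apply: H; apply/planes_on2E.
Qed.

Lemma plane_closure2E a b c :
  plane_closure h [set a; b] c <-> forall P, h P a -> h P b -> h P c.
Proof.
split=> [H P ha hb|H P /points_on2E[]]; last exact: H.
by apply: H; apply/points_on2E.
Qed.

End DualIncidence.

Arguments points_on3E {Point Plane h a b c P}.
Arguments point_closure2E {Point Plane h A B C}.
Arguments plane_closure2E {Point Plane h a b c}.

Section Collinearity.
Variables (Point Plane : Type) (h : Point -> Plane -> Prop).
Hypothesis ax4 : axiom4 h.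

(** By [4] the points common to [a] and [b] form the line [AB]; [C] is one of them, so every plane
    through [A] and [B] contains it. *)
Lemma collinear_on A B C a b c : A <> B -> a <> b ->
    h A a -> h B a -> h C a -> h A b -> h B b -> h C b ->
  h A c -> h B c -> h C c.
Proof.
move=> nAB nab Aa Ba Ca Ab Bb Cb.
have [|_ eq_line] := ax4 _ _ _ _ nAB nab; first by move=> _ _ [|] -> [|] ->.
apply: (point_closure2E (h := h)).1.
by rewrite -eq_line; apply/points_on2E.
Qed.

(** The plane [a] certifies that [A], [B], [C] are not collinear: two distinct planes through all
    three would put [C] on the line [AB], hence on [a]. *)
Lemma triangle_plane_unique A B C a s t : A <> B -> ~ h C a ->
    h A a -> h B a -> h A s -> h B s -> h C s ->
  h A t -> h B t -> h C t -> t = s.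
Proof.
move=> nAB nCa Aa Ba As Bs Cs At Bt Ct; apply: contrapT => nts.
exact/nCa/(collinear_on A B C t s a).
Qed.

(** The planes [a] and [b] cut [s] in the lines [AB] and [CD]. A second common point [Z] would make
    [ZY] the line of [a] and [s]; it would contain [A] and lie in [b]. *)
Lemma closures_meet A B C D Y a b s : a <> s -> b <> s -> A <> B -> C <> D ->
    h A s -> h B s -> h C s -> h D s -> h A a -> h B a -> h C b -> h D b ->
    ~ h A b -> h Y a -> h Y b -> h Y s ->
  [set Y] = point_closure h [set A; B] `&` point_closure h [set C; D].
Proof.
move=> nas nbs nAB nCD As Bs Cs Ds Aa Ba Cb Db nAb Ya Yb Ys.
apply/seteqP; split=> [_ ->|Z [/point_closure2E ZAB /point_closure2E ZCD]].
  split; apply/point_closure2E => c.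
    exact: (collinear_on A B Y a s c).
  exact: (collinear_on C D Y b s c).
apply: contrapT => nZY; apply: nAb.
by apply: (collinear_on Z Y A a s b) => //; [apply: ZAB | apply: ZAB | apply: ZCD].
Qed.

End Collinearity.

Lemma axiomH_axiomHstar (Point Plane : Type) (h : Point -> Plane -> Prop) :
  axiom1 h -> axiom3 h -> axiom4 h -> axiomH h -> axiomHstar h.
Proof.
move=> ax1 ax3 ax4 axH P p0 p1 p2 p3.
move=> /(_ P erefl) P0 /(_ P erefl) P1 /(_ P erefl) P2 /(_ P erefl) P3.
have elim3 a b c : points_on h [set a; b; c] = [set P] ->
    forall Q, h Q a -> h Q b -> h Q c -> Q = P.
  by move=> E Q Qa Qb Qc; suff: [set P] Q by []; rewrite -E; apply/points_on3E.
move=> /elim3 m012 /elim3 m013 /elim3 m023 /elim3 m123 d1 d2 d3.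
have elimI d a b c e :
    [set d] = plane_closure h [set a; b] `&` plane_closure h [set c; e] ->
    (forall Q, h Q a -> h Q b -> h Q d) /\ (forall Q, h Q c -> h Q e -> h Q d).
  move=> E; have [] : (plane_closure h [set a; b] `&` plane_closure h [set c; e]) d.
    by rewrite -E.
  by move=> /plane_closure2E ? /plane_closure2E.
move=> /elimI[d1_01 d1_23] /elimI[d2_02 d2_31] /elimI[d3_03 d3_12].
have Pd1 : h P d1 by apply: d1_01.
have Pd2 : h P d2 by apply: d2_02.
have Pd3 : h P d3 by apply: d3_03.
apply/seteqP; split=> [X /points_on3E[Xd1 Xd2 Xd3]|_ ->]; last first.
  exact/points_on3E.
apply: contrapT => /= nXP.
have [s nPs] := plane_avoiding _ _ h P ax1.
have neq_s a : h P a -> a <> s by move=> Pa eas; apply: nPs; rewrite -eas.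
have [A01 [A01_0 A01_1 A01s]] := common_point _ _ h p0 p1 s ax3.
have [A23 [A23_2 A23_3 A23s]] := common_point _ _ h p2 p3 s ax3.
have [A02 [A02_0 A02_2 A02s]] := common_point _ _ h p0 p2 s ax3.
have [A13 [A13_1 A13_3 A13s]] := common_point _ _ h p1 p3 s ax3.
have [A03 [A03_0 A03_3 A03s]] := common_point _ _ h p0 p3 s ax3.
have [A12 [A12_1 A12_2 A12s]] := common_point _ _ h p1 p2 s ax3.
(* If [d1] and [d2] differ, they meet in the line [XP], which lies in [d3]; so any point that they
   share with [s] is on [d3] too. *)
have [Y [Yd1 Yd2 Yd3 Ys]] : exists Y, [/\ h Y d1, h Y d2, h Y d3 & h Y s].
  have [eq_d|neq_d] := pselect (d1 = d2).
    have [Y [Yd1 Yd3 Ys]] := common_point _ _ h d1 d3 s ax3.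
    by exists Y; split=> //; rewrite -eq_d.
  have [Y [Yd1 Yd2 Ys]] := common_point _ _ h d1 d2 s ax3.
  exists Y; split=> //.
  exact: (collinear_on _ _ h ax4 X P Y d1 d2 d3).
have not_P Q : h Q s -> Q <> P by move=> Qs eQP; apply: nPs; rewrite -eQP.
(* A vertex on a third plane [p_k] would be [P], which is not on [s]. *)
have A01_n2 : ~ h A01 p2 by move=> H; apply: (not_P A01) => //; apply: m012.
have A01_n3 : ~ h A01 p3 by move=> H; apply: (not_P A01) => //; apply: m013.
have A23_n0 : ~ h A23 p0 by move=> H; apply: (not_P A23) => //; apply: m023.
have A23_n1 : ~ h A23 p1 by move=> H; apply: (not_P A23) => //; apply: m123.
have A02_n1 : ~ h A02 p1 by move=> H; apply: (not_P A02) => //; apply: m012.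
have A13_n0 : ~ h A13 p0 by move=> H; apply: (not_P A13) => //; apply: m013.
have A13_n2 : ~ h A13 p2 by move=> H; apply: (not_P A13) => //; apply: m123.
have sep A B a : h A a -> ~ h B a -> A <> B.
  by move=> Aa nBa eAB; apply: nBa; rewrite -eAB.
have n_01_23 := sep _ _ _ A01_0 A23_n0.
have n_01_02 := sep _ _ _ A01_1 A02_n1.
have n_01_13 := sep _ _ _ A01_0 A13_n0.
have n_02_13 := sep _ _ _ A02_0 A13_n0.
have n_23_02 := nesym (sep _ _ _ A02_0 A23_n0).
have n_13_23 := sep _ _ _ A13_1 A23_n1.
have tri := triangle_plane_unique _ _ h ax4.
(* Otherwise [d2] would contain the triangle [A01], [A02], [A13] and so equal [s], although [P] is
   on [d2]. This keeps the lines [A01 A23] and [A02 A13] distinct. *)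
have A01_nd2 : ~ h A01 d2.
  move=> A01d2; apply: (neq_s d2) => //.
  by apply: (tri A01 A02 A13 p0) => //; [exact: d2_02 | exact: d2_31].
have on_s Q : h Q s -> points_on h [set s] Q by move=> Qs _ ->.
have diag : planes_on h [set Y; A03; A12] = [set s].
  apply: (axH s A01 A23 A02 A13); try exact: on_s.
  (* In each triple, the plane passed to [tri] contains two of the points and misses the third. *)
  - by apply: planes_on3_eq1 => // t ? ? ?; apply: (tri A01 A02 A23 p0).
  - by apply: planes_on3_eq1 => // t ? ? ?; apply: (tri A01 A13 A23 p1).
  - by apply: planes_on3_eq1 => // t ? ? ?; apply: (tri A01 A02 A13 p0).
  - by apply: planes_on3_eq1 => // t ? ? ?; apply: (tri A23 A02 A13 p2).
  (* The pairs of opposite sides are cut out on [s] by [d1] and [d2], by [p0] and [p3], and by [p1]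
     and [p2]. *)
  - apply: (closures_meet _ _ h ax4 _ _ _ _ _ d1 d2 s) => //;
      by [exact: neq_s | exact: d1_01 | exact: d1_23 | exact: d2_02 | exact: d2_31].
  - by apply: (closures_meet _ _ h ax4 _ _ _ _ _ p0 p3 s) => //; exact: neq_s.
  - by apply: (closures_meet _ _ h ax4 _ _ _ _ _ p1 p2 s) => //; exact: neq_s.
apply: (neq_s d3) => //; suff: [set s] d3 by [].
by rewrite -diag; apply/planes_on3E; split; [|exact: d3_03|exact: d3_12].
Qed.

Theorem theorem1 (Point Plane : Type) (h : Point -> Plane -> Prop)
    (Point_nonempty : [set: Point] !=set0)
    (Plane_nonempty : [set: Plane] !=set0)
    (ax1 : axiom1 h) (ax2 : axiom2 h) (ax3 : axiom3 h) (ax4 : axiom4 h) :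
  axiomH h <-> axiomHstar h.
Proof.
split; first exact: axiomH_axiomHstar.
(* For the transposed relation, [axiomH] and [axiomHstar] unfold to [axiomHstar h] and [axiomH h];
   the axioms only have their two halves swapped. *)
apply: (@axiomH_axiomHstar _ _ (fun pi P => h P pi)).
- by case: ax1.
- by case: ax3.
- move=> a b A B nab nAB inc.
  have [|eqAB eqab] := ax4 _ _ _ _ nAB nab; last by split.
  by move=> Q pi Q_AB pi_ab; exact: inc.
Qed.
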